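(* Assume the inner tableau translation conjecture: for all $1\le k<n$, all $R,R'\in SYT_k$ of the same shape, and all $S,T\in SYT_n^{R}$ with $S\leq_{weak}T$, one has $\mathcal{V}_{[R,R']}(S)\leq_{weak}\mathcal{V}_{[R,R']}(T)$. Then for every $n$ the weak order on $SYT_n$ is well defined, i.e. the relation $\leq_{weak}$ on $SYT_n$ is antisymmetric (if $S\leq_{weak}T$ and $S\neq T$ then $T\not\leq_{weak}S$), and hence is a partial order.
   Context: $SYT_n$ is the set of standard Young tableaux with $n$ cells (English convention, rows and columns increasing). For a permutation $w\in \mathfrak{S}_n$ (written in one-line notation $w_1\ldots w_n$), $I(w)\in SYT_n$ is its Robinson–Schensted (row) insertion tableau, and for $T\in SYT_n$, $\mathcal{Y}_T=\{w\in \mathfrak{S}_n: I(w)=T\}$ is its Knuth class. The right weak Bruhat order on $\mathfrak{S}_n$ is the transitive (and reflexive) closure of: $u\leq_{weak} w$ if $w=u\cdot s_i$ with $\mathrm{length}(w)=\mathrm{length}(u)+1$, where $s_i=(i,i+1)$; that is, $w$ is obtained from $u=u_1\ldots u_n$ by swapping the letters $u_i<u_{i+1}$ in adjacent positions. The relation $\leq_{weak}$ on $SYT_n$ (the weak order) is the transitive closure of the relation: $S\leq_{weak}T$ if there exist $\sigma\in\mathcal{Y}_S$, $\tau\in\mathcal{Y}_T$ with $\sigma\leq_{weak}\tau$. For $1\le k<n$ and $R\in SYT_k$, $SYT_n^{R}$ is the set of $T\in SYT_n$ whose subtableau consisting of the entries $1,\ldots,k$ equals $R$. For $R,R'\in SYT_k$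 of the same shape, the inner tableau translation map $\mathcal{V}_{[R,R']}:SYT_n^{R}\to SYT_n^{R'}$ sends $T$ to the tableau obtained by replacing the inner tableau $R$ of $T$ with $R'$ (leaving the other entries in place). *)

(* Defs.v *)
From Stdlib Require Import Relation_Definitions Relation_Operators.
From HB Require Import structures.
From mathcomp Require Import all_boot all_fingroup.

Set Implicit Arguments.
Unset Strict Implicit.
Unset Printing Implicit Defensive.

Import GroupScope.

(* A tableau is the list of its rows, from top to bottom (English convention);
   entries are 1, ..., n.  Rows are nonempty, so that a tableau has only one
   representation; [shape T = map size T] comes from [seq]. *)
Definition tableau := seq (seq nat).

(* The row [s] may be placed immediately below the row [r]. *)
Definition below (r s : seq nat) : bool :=
  (size s <= size r) && all (fun j => nth 0 r j < nth 0 s j) (iota 0 (size s)).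

Definition is_syt (n : nat) (T : tableau) : bool :=
  [&& all (fun r => 0 < size r) T, all (sorted ltn) T, sorted below T
    & perm_eq (flatten T) (iota 1 n)].

Definition syt (n : nat) := {T : tableau | is_syt n T}.

Fixpoint row_insert (T : tableau) (x : nat) : tableau :=
  if T is r :: T' then
    let j := find (fun y => x < y) r in
    if j < size r then set_nth 0 r j x :: row_insert T' (nth 0 r j)
    else rcons r x :: T'
  else [:: [:: x]].

(* ['S_n] permutes {0, ..., n-1}: letters are shifted by one. *)
Definition one_line (n : nat) (w : 'S_n) : seq nat :=
  [seq (w i).+1 | i <- enum 'I_n].

Definition insertion_tableau (n : nat) (w : 'S_n) : tableau :=
  foldl row_insert [::] (one_line w).

Definition knuth_class (n : nat) (T : syt n) : {set 'S_n} :=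
  [set w | insertion_tableau w == val T].

Definition perm_length (n : nat) (w : 'S_n) : nat :=
  #|[set p : 'I_n * 'I_n | (p.1 < p.2) && (w p.2 < w p.1)]|.

(* In MathComp, [(s * u) x = u (s x)], so [tperm i j * u] is the product
   written u . s_i when functions compose from right to left: it exchanges the
   letters of [u] in positions [i] and [j = i + 1]. *)
Definition weak_cover (n : nat) : rel 'S_n := fun u w =>
  [exists i : 'I_n, exists j : 'I_n,
    [&& j == i.+1 :> nat, w == tperm i j * u
      & perm_length w == (perm_length u).+1]].

Definition perm_weak (n : nat) : rel 'S_n := connect (@weak_cover n).

Definition syt_weak (n : nat) : relation (syt n) :=
  clos_trans (syt n) (fun S T =>
    exists s t : 'S_n,
      [/\ s \in knuth_class S, t \in knuth_class T & perm_weak s t]).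

(* The subtableau of entries at most [k]; rows left without entries vanish. *)
Definition subtableau (k : nat) (T : tableau) : tableau :=
  [seq r <- [seq [seq x <- r | x <= k] | r <- T] | 0 < size r].

Definition syt_over (n k : nat) (R : syt k) :=
  {T : syt n | subtableau k (val T) == val R}.

(* The cells of [R'] get the entries of [R'], the others keep those of [T]. *)
Definition replace_inner (R' T : tableau) : tableau :=
  [seq nth [::] R' i ++ drop (size (nth [::] R' i)) (nth [::] T i)
     | i <- iota 0 (size T)].

Lemma below_refines r s j : below r s -> j < size s -> nth 0 r j < nth 0 s j.
Proof.
by case/andP=> _ /allP h lt; apply: h; rewrite mem_iota.
Qed.

Lemma sorted_ltn_split k r : sorted ltn r ->
  r = [seq x <- r | x <= k] ++ [seq x <- r | k < x].
Proof.
elim: r => //= x r IH pr.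
have sr := path_sorted pr; case: leqP => [_|ltkx] /=.
  by rewrite -IH.
have all_r : all (fun y => k < y) r.
  apply/allP=> y yr; apply: ltn_trans ltkx _.
  by move: pr; rewrite (path_sortedE ltn_trans) => /andP[/allP/(_ y yr)].
rewrite (eq_in_filter (a2 := pred0)) ?filter_pred0 ?(all_filterP all_r) // => y yr.
by apply/negbTE; rewrite -ltnNge (allP all_r).
Qed.

Lemma nth_subtableau k T i : all (sorted ltn) T -> sorted below T ->
  nth [::] (subtableau k T) i = [seq x <- nth [::] T i | x <= k].
Proof.
rewrite /subtableau.
elim: T i => [|r T IH] i /=; first by rewrite !nth_nil.
case/andP=> sr sT pT; have bT := path_sorted pT.
case: ifP => [_|/negbT]; first by case: i => //= i; apply: IH.
rewrite -eqn0Ngt size_filter -leqn0 leqNgt -has_count => hr.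
have h0 : forall i, [seq x <- nth [::] (r :: T) i | x <= k] = [::].
  move=> {IH}{}i.
  apply/eqP; rewrite -size_eq0 size_filter -leqn0 leqNgt -has_count.
  elim: i r T sr sT pT bT hr => [//|i IHi] r [|s T] /= sr sT pT bT hr.
    by rewrite nth_nil.
  case/andP: sT => ss sT; case/andP: pT => brs pT.
  apply: (IHi s T) => //; first exact: path_sorted pT.
  apply/hasPn=> x /(nthP 0)[j js <-]; rewrite -ltnNge.
  have lt := below_refines brs js; apply: leq_trans (ltnW lt).
  rewrite ltnNge; apply: (hasPn hr); apply: mem_nth.
  by case/andP: brs => le _; apply: leq_trans le.
rewrite h0 IH //.
have := h0 i.+1; rewrite /= => ->.
by [].
Qed.

Lemma nth_below T i : sorted below T -> i.+1 < size T ->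
  below (nth [::] T i) (nth [::] T i.+1).
Proof. by move=> sT; apply/sortedP. Qed.

Lemma perm_flatten_cat (I : Type) (A B : I -> seq nat) s :
  perm_eq (flatten [seq A i ++ B i | i <- s])
          (flatten [seq A i | i <- s] ++ flatten [seq B i | i <- s]).
Proof.
elim: s => //= i s IH; apply/seq.permP=> p; move/seq.permP: IH => /(_ p).
by rewrite !count_cat => ->; rewrite addnACA.
Qed.

Lemma flatten_nth_iota (T : tableau) m : size T <= m ->
  flatten [seq nth [::] T i | i <- iota 0 m] = flatten T.
Proof.
move=> le; rewrite -(subnKC le) iotaD map_cat flatten_cat add0n.
rewrite -[in RHS](cats0 (flatten T)); congr (_ ++ _).
  by rewrite -/(mkseq _ _) mkseq_nth.
move: (m - size T) => d; have := leqnn (size T).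
elim: d {-1}(size T) => //= d IH a lea.
by rewrite nth_default // IH // ltnW.
Qed.

Lemma size_nth_shape (R R' : tableau) i : shape R = shape R' ->
  size (nth [::] R i) = size (nth [::] R' i).
Proof. by move=> sh; rewrite -!nth_shape sh. Qed.

Lemma syt_le k (R : syt k) i j : j < size (nth [::] (val R) i) ->
  nth 0 (nth [::] (val R) i) j <= k.
Proof.
case: R => R /= /and4P[_ _ _ pR] lt.
have iR : i < size R.
  by rewrite ltnNge; apply: contraTN lt => le; rewrite nth_default.
suff : nth 0 (nth [::] R i) j \in iota 1 k.
  by rewrite mem_iota add1n ltnS => /andP[].
rewrite -(perm_mem pR); apply/flattenP; exists (nth [::] R i); exact: mem_nth.
Qed.

Lemma replace_inner_subproof n k (R R' : syt k) (T : tableau) :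
  is_syt n T -> subtableau k T = val R -> shape (val R) = shape (val R') ->
  is_syt n (replace_inner (val R') T) &&
  (subtableau k (replace_inner (val R') T) == val R').
Proof.
move=> sT eR sh.
have [T0 Tr Tb Tp] := and4P sT.
have [R0 Rr Rb Rp] := and4P (valP R).
have [R'0 R'r R'b R'p] := and4P (valP R').
pose U i := [seq x <- nth [::] T i | k < x].
have rowT i : nth [::] T i = nth [::] (val R) i ++ U i.
  rewrite -eR nth_subtableau // -sorted_ltn_split //.
  have [lt|ge] := ltnP i (size T); last by rewrite nth_default.
  by rewrite (allP Tr) ?mem_nth.
have szR i : size (nth [::] (val R) i) = size (nth [::] (val R') i).
  exact: size_nth_shape.
have leRT : size (val R') <= size T.
  have <- : size (val R) = size (val R') by have := congr1 size sh; rewrite !size_map.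
  by rewrite -eR size_filter (leq_trans (count_size _ _)) ?size_map.
have Ugt i j : j < size (U i) -> k < nth 0 (U i) j.
  by move=> lt; have := mem_nth 0 lt; rewrite mem_filter => /andP[].
set V := replace_inner _ _.
have sV : size V = size T by rewrite size_map size_iota.
have rowV i : nth [::] V i = nth [::] (val R') i ++ U i.
  have [lt|ge] := ltnP i (size T); last first.
    by rewrite !nth_default ?sV ?(leq_trans leRT) // /U nth_default.
  by rewrite (nth_map 0) ?size_iota // nth_iota // add0n rowT -szR drop_size_cat.
have szV i : size (nth [::] V i) = size (nth [::] T i).
  by rewrite rowV rowT !size_cat szR.
have Vr : all (sorted ltn) V.
  apply/(all_nthP [::]) => i; rewrite sV => lt.
  have := all_nthP [::] Tr i lt.
  rewrite rowV rowT !(sorted_pairwise ltn_trans) !pairwise_cat => /and3P[_ _ ->].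
  rewrite andbT; apply/andP; split.
    apply/allrelP=> x y /(nthP 0)[j ltj <-] /(nthP 0)[l ltl <-].
    exact: leq_ltn_trans (syt_le ltj) (Ugt _ _ ltl).
  rewrite -(sorted_pairwise ltn_trans).
  have [ltR|geR] := ltnP i (size (val R')); last by rewrite nth_default.
  by rewrite (allP R'r) ?mem_nth.
have Vb : sorted below V.
  apply/(sortedP [::]) => i; rewrite sV => lt.
  have bT := nth_below Tb lt.
  apply/andP; split; first by rewrite !szV; case/andP: bT.
  apply/allP=> j; rewrite mem_iota /= add0n => ltj.
  rewrite szV in ltj; have := below_refines bT ltj.
  have := ltj; rewrite !rowV !rowT size_cat !nth_cat !szR => ltj'.
  case: ifP => h1; case: ifP => h2 // _; last first.
  - have ltR : i.+1 < size (val R').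
      by rewrite ltnNge; apply: contraTN h2 => le; rewrite (nth_default _ le).
    have /andP[le _] := nth_below R'b ltR.
    by rewrite (leq_trans h2 le) in h1.
  - apply: leq_ltn_trans (syt_le h1) _; apply: Ugt.
    by rewrite ltn_subLR // leqNgt h2.
  - have ltR : i.+1 < size (val R').
      by rewrite ltnNge; apply: contraTN h2 => le; rewrite (nth_default _ le).
    exact: below_refines (nth_below R'b ltR) h2.
have V0 : all (fun r => 0 < size r) V.
  apply/(all_nthP [::]) => i; rewrite sV szV; exact: (all_nthP [::] T0).
have fl (A : tableau) : size A <= size T ->
    perm_eq (flatten [seq nth [::] A i ++ U i | i <- iota 0 (size T)])
            (flatten A ++ flatten [seq U i | i <- iota 0 (size T)]).
  by move=> le; rewrite (permPl (perm_flatten_cat _ _ _)) flatten_nth_iota.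
have Vp : perm_eq (flatten V) (iota 1 n).
  have -> : V = [seq nth [::] (val R') i ++ U i | i <- iota 0 (size T)].
    by rewrite -[LHS](mkseq_nth [::]) sV; apply: eq_map.
  rewrite (permPl (fl _ leRT)) -(permPr Tp).
  have -> : T = [seq nth [::] (val R) i ++ U i | i <- iota 0 (size T)].
    by rewrite -[LHS](mkseq_nth [::]); apply: eq_map.
  rewrite size_map size_iota (permPr (fl _ _)).
    by rewrite perm_cat2r (permPl R'p) perm_sym.
  by have := congr1 size sh; rewrite !size_map => ->.
rewrite /is_syt V0 Vr Vb Vp /=; apply/eqP.
have eqrow i : nth [::] (subtableau k V) i = nth [::] (val R') i.
  rewrite nth_subtableau // rowV filter_cat.
  rewrite (all_filterP (_ : all _ (nth [::] (val R') i))).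
    rewrite -[RHS]cats0; congr (_ ++ _); rewrite -filter_predI.
    rewrite (eq_filter (a2 := pred0)) ?filter_pred0 // => x /=.
    by case: leqP => //=.
  by apply/(all_nthP 0) => j; apply: syt_le.
have eqs (A B : tableau) : all (fun r => 0 < size r) A ->
    (forall i, nth [::] A i = nth [::] B i) -> size A <= size B.
  move=> A0 e; rewrite leqNgt; apply/negP=> lt.
  by have := all_nthP [::] A0 _ lt; rewrite e nth_default.
have s0 : all (fun r => 0 < size r) (subtableau k V) by apply: filter_all.
apply: (@eq_from_nth _ [::]) => [|i _]; last exact: eqrow.
by apply/eqP; rewrite eqn_leq !eqs.
Qed.

Lemma replace_innerP n k (R R' : syt k) (T : syt_over n R) :
  shape (val R) = shape (val R') ->
  is_syt n (replace_inner (val R') (val (val T))) &&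
  (subtableau k (replace_inner (val R') (val (val T))) == val R').
Proof.
by move=> sh; apply: replace_inner_subproof sh;
  [apply: valP (val T) | apply/eqP/(valP T)].
Qed.

Definition inner_translation (n k : nat) (R R' : syt k)
    (sh : shape (val R) = shape (val R')) (T : syt_over n R) : syt_over n R' :=
  let H := andP (replace_innerP T sh) in
  exist _ (exist _ (replace_inner (val R') (val (val T))) (proj1 H)) (proj2 H).

Definition inner_translation_conjecture : Prop :=
  forall (n k : nat), 1 <= k < n ->
  forall (R R' : syt k) (sh : shape (val R) = shape (val R'))
    (S T : syt_over n R),
  syt_weak (val S) (val T) ->
  syt_weak (val (inner_translation sh S)) (val (inner_translation sh T)).

(* Main.v *)
Require Import Defs.
From Stdlib Require Import Relation_Definitions Relation_Operators.
From mathcomp Require Import all_boot all_fingroup zify.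

Set Implicit Arguments.
Unset Strict Implicit.
Unset Printing Implicit Defensive.

(** The proof plays descents against inner translation.  Call [k] a descent of a
    tableau when [k.+1] lies in a strictly lower row than [k].  Row insertion
    never changes which of [k] and [k.+1] comes first in the reading word
    ([filter_insertion]), so [k] is a descent of the insertion tableau of [w]
    exactly when [k.+1] precedes [k] in [w].  Going up in the right weak order
    only creates inversions, hence [S <= T] forces every descent of [S] to be a
    descent of [T] ([syt_weak_descent]).

    Descents alone do not separate tableaux, but the translates of [S] and [T]
    have descents too.  Let [S <= T <= S], and suppose by induction on [k] that
    [S] and [T] have the same subtableau [R] of entries at most [k].  If [k.+1]
    lay in row [a.+1] of [S] and in a row [b <= a] of [T], then row [a] of [R]
    would be longer than row [a.+1], so that some tableau [R'] of the shape of
    [R] has its largest entry [k] at the end of row [a]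
    ([syt_with_max_at_corner]).  Replacing [R] by [R'] keeps [k.+1] where it
    was, so [k] becomes a descent of the translate of [S] and not of the
    translate of [T]; yet the conjecture says that the first is at most the
    second.  Hence [k.+1] lies in the same row of [S] and [T]
    ([syt_weak_next_row]), and the subtableaux of entries at most [k.+1] agree
    too.  For [k = n] this gives [S = T] ([eq_subtableau]).

    Reflexivity is the remaining point: a tableau is related to itself because
    its Knuth class contains its own reading word ([insertion_row_word]). *)

(** * Reading words *)

(** Rows are read from the bottom up.  In this order row insertion is a sequence
    of Knuth moves, and [k.+1] is read before [k] exactly at the descents. *)
Definition row_word (T : tableau) : seq nat := flatten (rev T).

Lemma row_word_cons r T : row_word (r :: T) = row_word T ++ r.
Proof. by rewrite /row_word rev_cons flatten_rcons. Qed.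

Lemma perm_row_word T : perm_eq (row_word T) (flatten T).
Proof. by rewrite perm_flatten // perm_rev. Qed.

Lemma subseq_pairE (s : seq nat) x y : uniq s -> x != y ->
  subseq [:: x; y] s = ([seq z <- s | pred2 x y z] == [:: x; y]).
Proof.
move=> us nxy; apply/(subseq_uniqP us)/eqP => e; [rewrite [RHS]e|rewrite -[LHS]e];
  by apply: eq_filter => z; rewrite !inE.
Qed.

(** * Row insertion and consecutive letters *)

Lemma row_bumpP r x : sorted ltn r -> x \notin r ->
  let j := find (fun y => x < y) r in j < size r ->
  exists r1 r2, [/\ r = r1 ++ nth 0 r j :: r2, set_nth 0 r j x = r1 ++ x :: r2,
    all (fun a => a < x) r1, x < nth 0 r j & all (fun b => nth 0 r j < b) r2].
Proof.
move=> sr xr j jr; exists (take j r), (drop j.+1 r).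
have er : r = take j r ++ nth 0 r j :: drop j.+1 r.
  by rewrite -drop_nth // cat_take_drop.
split=> //; first by rewrite set_nthE jr.
- apply/allP => a /(nthP 0)[l]; rewrite size_take jr => lj <-.
  rewrite nth_take // ltn_neqAle leqNgt (before_find 0 lj) andbT.
  by apply: contraNneq xr => <-; apply/mem_nth/(ltn_trans lj).
- by apply: (nth_find 0); rewrite has_find.
- move: sr; rewrite {1}er (sorted_pairwise ltn_trans) pairwise_cat pairwise_cons.
  by case/and3P=> _ _ /andP[].
Qed.

Lemma uniq_bumped (x y : nat) r T :
  uniq (x :: flatten (r :: T)) -> y \in r -> uniq (y :: flatten T).
Proof.
rewrite /= cat_uniq => /and4P[_ _ /hasPn rT ->] yr; rewrite andbT.
by apply/negP => /rT; rewrite /= yr.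
Qed.

Lemma perm_row_insert T x : all (sorted ltn) T -> uniq (x :: flatten T) ->
  perm_eq (flatten (row_insert T x)) (x :: flatten T).
Proof.
elim: T x => [|r T IH] x //= /andP[sr sT] ux.
have xr : x \notin r by move: ux; rewrite /= mem_cat negb_or -andbA => /and3P[].
case: ifP => [jr|_] /=; last by rewrite cat_rcons perm_sym -cat1s perm_catCA.
have uy := uniq_bumped ux (mem_nth 0 jr).
have [r1 [r2 []]] := row_bumpP sr xr jr.
set y := nth 0 r _ in uy *; move=> er -> _ _ _.
apply/seq.permP => p; move/seq.permP: (IH _ sT uy) => /(_ p).
by rewrite er /= !count_cat /= => ->; lia.
Qed.

Lemma sorted_row_insert T x : all (sorted ltn) T -> uniq (x :: flatten T) ->
  all (sorted ltn) (row_insert T x).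
Proof.
elim: T x => [|r T IH] x //= /andP[sr sT] ux.
have xr : x \notin r by move: ux; rewrite /= mem_cat negb_or -andbA => /and3P[].
case: ifP => [jr|/negbT jr] /=.
  rewrite IH ?(uniq_bumped ux (mem_nth 0 jr)) // andbT.
  have [r1 [r2 [er -> r1x xy yr2]]] := row_bumpP sr xr jr.
  move: sr; rewrite {1}er !(sorted_pairwise ltn_trans) !pairwise_cat !pairwise_cons.
  rewrite !allrel_consr => /and3P[/andP[_ ->] -> /andP[_ ->]].
  rewrite r1x !andbT /=; apply: sub_all yr2 => b; exact: ltn_trans.
rewrite sT andbT -cats1 (sorted_pairwise ltn_trans) pairwise_cat.
rewrite -(sorted_pairwise ltn_trans) sr /= andbT allrel1r.
move: jr; rewrite -has_find => /hasPn jr; apply/allP => a ar.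
by rewrite ltn_neqAle leqNgt jr // andbT; apply: contraNneq xr => <-.
Qed.

(** When [x] bumps [y] out of [r1 ++ y :: r2], the word [r1 y r2 x] becomes
    [y r1 x r2], so [y] overtakes letters smaller than [x] and [x] overtakes
    letters larger than [y].  Since [x < y], the two letters that trade places
    have a third one strictly between them and are not consecutive. *)
Lemma no_letter_between k a x b :
  pred2 k.+1 k a -> pred2 k.+1 k b -> a < x -> x < b -> False.
Proof. by do 2![case/pred2P=> ->]; lia. Qed.

(** Induction on the rows: appending [x] to the reading word and bumping [y] in
    the first row puts [y] at the end of the reading word of the other rows,
    which is the same situation one row lower. *)
Lemma filter_row_insert k T x : all (sorted ltn) T -> uniq (x :: flatten T) ->
  [seq z <- row_word (row_insert T x) | pred2 k.+1 k z]
    = [seq z <- row_word T ++ [:: x] | pred2 k.+1 k z].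
Proof.
elim: T x => [|r T IH] x //= /andP[sr sT] ux.
have xr : x \notin r by move: ux; rewrite /= mem_cat negb_or -andbA => /and3P[].
case: ifP => [jr|_]; rewrite !row_word_cons; last by rewrite -cats1 catA.
have uy := uniq_bumped ux (mem_nth 0 jr).
have [r1 [r2 []]] := row_bumpP sr xr jr.
set y := nth 0 r _ in uy *; move=> er -> r1x xy yr2.
rewrite filter_cat (IH _ sT uy).
have r1y : pred2 k.+1 k y -> [seq z <- r1 | pred2 k.+1 k z] = [::].
  move=> py; rewrite (eq_in_filter (a2 := pred0)) ?filter_pred0 // => a /(allP r1x) ax.
  by apply/negP => pa; apply: no_letter_between pa py ax xy.
have r2x : pred2 k.+1 k x -> [seq z <- r2 | pred2 k.+1 k z] = [::].
  move=> px; rewrite (eq_in_filter (a2 := pred0)) ?filter_pred0 // => b /(allP yr2) yb.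
  by apply/negP => pb; apply: no_letter_between px pb xy yb.
rewrite er !filter_cat -!catA /=.
(* At most one of each of the pairs (y, r1) and (x, r2) meets {k, k+1}. *)
move: r1y r2x; rewrite /=; case: ifP => [_ ->|_ _] //; case: ifP => [_ ->|_ _] //=.
all: by rewrite ?cats0.
Qed.

Lemma filter_insertion k T w : all (sorted ltn) T -> uniq (flatten T ++ w) ->
  [seq z <- row_word (foldl row_insert T w) | pred2 k.+1 k z]
    = [seq z <- row_word T ++ w | pred2 k.+1 k z].
Proof.
elim: w T => [|x w IH] T sT u; first by rewrite cats0.
have ux : uniq (x :: flatten T).
  by move: u; rewrite -cat_rcons cat_uniq -(perm_uniq (permEl (perm_rcons _ _))) => /andP[].
have uT' : uniq (flatten (row_insert T x) ++ w).
  rewrite (perm_uniq (_ : perm_eq _ (flatten T ++ x :: w))) //.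
  rewrite -cat_rcons perm_cat2r (perm_trans (perm_row_insert sT ux)) //.
  by rewrite perm_sym perm_rcons.
rewrite [LHS](IH _ (sorted_row_insert sT ux) uT').
by rewrite filter_cat filter_row_insert // -filter_cat -catA.
Qed.

(** * The reading word of a tableau inserts to that tableau *)

(** Each entry of [r] is larger than the entries of [a ++ r] placed before it and
    smaller than the entry of [s] in its own column, so it bumps precisely that
    entry (or is appended once [s] is used up): [r] pushes [s] down entry by
    entry.  The prefix [a] is what makes the induction on [r] go through. *)
Lemma insert_row_below a s r U :
  sorted ltn (a ++ r) -> below r s ->
  foldl row_insert ((a ++ s) :: U) r = (a ++ r) :: foldl row_insert U s.
Proof.
elim: r a s U => [|x r IH] a s U; first by case: s => //; rewrite /below.
move=> sr /andP[szs /allP bs].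
have ax t : find (fun y => x < y) (a ++ t) = size a + find (fun y => x < y) t.
  move: sr; rewrite (sorted_pairwise ltn_trans) pairwise_cat allrel_consr -andbA.
  move=> /andP[/allP ax _]; rewrite find_cat ifN //; apply/hasPn => z /ax /=; lia.
case: s => [|y s] in szs bs * => /=; rewrite ax.
  rewrite cats0 addn0 ltnn -cats1.
  by have := IH (rcons a x) [::] U; rewrite cats0 cat_rcons cats1; apply.
have xy : x < y by apply: (bs 0).
rewrite /= xy addn0 size_cat -[X in X < _]addn0 ltn_add2l /=.
have -> : set_nth 0 (a ++ y :: s) (size a) x = rcons a x ++ s.
  by elim: (a) => //= z b ->.
rewrite nth_cat ltnn subnn /= IH ?cat_rcons //.
apply/andP; split=> //; apply/allP => j; rewrite mem_iota add0n => js.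
by apply: (bs j.+1); rewrite mem_iota.
Qed.

Lemma insert_top_row r T : all (fun r => 0 < size r) (r :: T) ->
  all (sorted ltn) (r :: T) -> sorted below (r :: T) ->
  foldl row_insert T r = r :: T.
Proof.
elim: T r => [|s T IH] r /= /andP[r0 T0] /andP[sr sT].
  case: r r0 sr => //= x r _ sr _.
  by rewrite -[[:: [:: x]]]/[:: [:: x] ++ [::]] (@insert_row_below [:: x]).
case/andP=> brs pT.
by rewrite -[s in s :: T]cat0s insert_row_below ?IH.
Qed.

Lemma insertion_row_word n T : is_syt n T -> foldl row_insert [::] (row_word T) = T.
Proof.
case/and4P=> + + + _; elim: T => [|r T IH] // T0 sT pT.
have /andP[_ T0'] := T0; have /andP[_ sT'] := sT.
by rewrite row_word_cons foldl_cat IH ?(path_sorted pT) // insert_top_row.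
Qed.

(** * Inversions and the right weak order *)

Lemma subseq_pairP (s : seq nat) x y :
  reflect (exists i j, [/\ i < j < size s, nth 0 s i = x & nth 0 s j = y])
          (subseq [:: x; y] s).
Proof.
apply: (iffP idP) => [|[i [j [/andP[ij js] <- <-]]]]; last first.
  rewrite -[s in subseq _ s](cat_take_drop j) -cat1s cat_subseq // sub1seq.
    by rewrite -(nth_take 0 ij) mem_nth // size_take js.
  by rewrite (drop_nth 0 js) mem_head.
elim: s => //= z s IH; case: eqP => [-> |_].
  by rewrite sub1seq => /(nthP 0)[j js <-]; exists 0, j.+1.
by case/IH => i [j [ij <- <-]]; exists i.+1, j.+1.
Qed.

Lemma nth_one_line n (w : 'S_n) (i : 'I_n) : nth 0 (one_line w) i = (w i).+1.
Proof. by rewrite (nth_map i) ?size_enum_ord // nth_ord_enum. Qed.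

Lemma size_one_line n (w : 'S_n) : size (one_line w) = n.
Proof. by rewrite size_map size_enum_ord. Qed.

Lemma uniq_one_line n (w : 'S_n) : uniq (one_line w).
Proof.
rewrite map_inj_in_uniq ?enum_uniq // => i j _ _ [] /val_inj; exact: perm_inj.
Qed.

Lemma one_lineP n (s : seq nat) : perm_eq s (iota 1 n) ->
  exists w : 'S_n, one_line w = s.
Proof.
move=> ps; have ss : size s = n by rewrite (perm_size ps) size_iota.
have us : uniq s by rewrite (perm_uniq ps) iota_uniq.
have s_bounds (i : 'I_n) : 0 < nth 0 s i <= n.
  have : nth 0 s i \in s by rewrite mem_nth ?ss.
  by rewrite (perm_mem ps) mem_iota add1n ltnS.
have lt (i : 'I_n) : (nth 0 s i).-1 < n by have := s_bounds i; lia.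
have inj : injective (fun i => Ordinal (lt i)).
  move=> i j [] e; apply/val_inj/eqP.
  rewrite -(nth_uniq 0 _ _ us) ?ss ?ltn_ord //; apply/eqP.
  have /andP[/prednK <- _] := s_bounds i; have /andP[/prednK <- _] := s_bounds j.
  by rewrite e.
exists (perm inj); apply: (@eq_from_nth _ 0); rewrite size_one_line ?ss // => i ltin.
rewrite -[i]/(val (Ordinal ltin)) nth_one_line permE /=.
by have /andP[/prednK] := s_bounds (Ordinal ltin).
Qed.

Lemma tperm_adjacent_mono n (i j : 'I_n) : j = i.+1 :> nat ->
  forall p q : 'I_n, p < q -> (p, q) != (i, j) -> tperm i j p < tperm i j q.
Proof.
move=> ji p q pq; rewrite xpair_eqE -!val_eqE /= => npq.
by do 2![case: tpermP => [?|?|/eqP + /eqP]; try subst]; rewrite -?val_eqE /=; lia.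
Qed.

(** If [u j < u i], exchanging the two letters removes the inversion [(i, j)],
    and [tperm i j] injects the remaining inversions into those of [u], so the
    length cannot grow. *)
Lemma weak_cover_lt n (u : 'S_n) (i j : 'I_n) : j = i.+1 :> nat ->
  perm_length u < perm_length (tperm i j * u) -> u i < u j.
Proof.
move=> ji; rewrite !ltnNge; apply: contra => uji.
rewrite /perm_length.
pose f (p : 'I_n * 'I_n) := (tperm i j p.1, tperm i j p.2).
have f_inj : injective f by move=> [a b] [c d] [] /perm_inj -> /perm_inj ->.
rewrite -(card_imset _ f_inj); apply/subset_leq_card/subsetP => _ /imsetP[[p q] + ->].
rewrite !inE /f /= !permM => /andP[pq wpq]; rewrite wpq andbT.
apply: tperm_adjacent_mono => //; apply: contraTneq wpq => -[-> ->].
by rewrite tpermL tpermR -leqNgt.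
Qed.

(** The only two letters whose order changes are those in positions [i] and [j],
    and they form no inversion of [u]. *)
Lemma weak_cover_inversion n (u w : 'S_n) x y : weak_cover u w -> y < x ->
  subseq [:: x; y] (one_line u) -> subseq [:: x; y] (one_line w).
Proof.
case/existsP=> i /existsP[j /and3P[/eqP ji /eqP -> /eqP lw]] yx.
have uij : u i < u j by apply: weak_cover_lt ji _; rewrite lw.
case/subseq_pairP => p [q [/andP[pq]]]; rewrite size_one_line => ltqn.
have ltpn := ltn_trans pq ltqn.
rewrite -[p]/(val (Ordinal ltpn)) -[q]/(val (Ordinal ltqn)) !nth_one_line => xE yE.
apply/subseq_pairP; exists (tperm i j (Ordinal ltpn)), (tperm i j (Ordinal ltqn)).
rewrite !nth_one_line !permM !tpermK size_one_line ltn_ord andbT; split=> //.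
apply: tperm_adjacent_mono => //; apply: contraTneq uij => -[<- <-].
by rewrite -leqNgt -ltnS yE xE ltnW.
Qed.

Lemma perm_weak_inversion n (u w : 'S_n) x y : perm_weak u w -> y < x ->
  subseq [:: x; y] (one_line u) -> subseq [:: x; y] (one_line w).
Proof.
case/connectP=> p + -> yx; elim: p u => //= v p IH u /andP[uv vp].
by move/(weak_cover_inversion uv yx)/(IH v vp).
Qed.

(** * Descents of tableaux *)

(** Phrased on the reading word, the condition is the one that a word passes on to
    its insertion tableau; [descent_rows] gives the usual form. *)
Definition descent (T : tableau) (k : nat) : bool :=
  subseq [:: k.+1; k] (row_word T).

Lemma uniq_row_word n (T : tableau) : is_syt n T -> uniq (row_word T).
Proof.
by case/and4P=> _ _ _ pT; rewrite (perm_uniq (perm_row_word T)) (perm_uniq pT) iota_uniq.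
Qed.

Lemma descent_insertion n (w : 'S_n) (T : syt n) k : w \in knuth_class T ->
  descent (val T) k = subseq [:: k.+1; k] (one_line w).
Proof.
rewrite inE => /eqP wT; have uT := uniq_row_word (valP T).
have nk : k.+1 != k by rewrite neq_ltn ltnSn orbT.
rewrite /descent !subseq_pairE ?uniq_one_line //.
by rewrite -wT filter_insertion ?uniq_one_line.
Qed.

Lemma syt_weak_descent n (S T : syt n) k : syt_weak S T ->
  descent (val S) k -> descent (val T) k.
Proof.
elim=> {S T}[S T [s [t [sS tT st]]]|S U T _ SU _ UT /SU/UT //].
by rewrite (descent_insertion _ sS) (descent_insertion _ tT); apply: perm_weak_inversion.
Qed.

Lemma knuth_class_neq0 n (T : syt n) : exists w, w \in knuth_class T.
Proof.
have [_ _ _ pT] := and4P (valP T).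
have [|w ew] := @one_lineP n (row_word (val T)).
  by rewrite (permPl (perm_row_word _)).
exists w; rewrite inE /insertion_tableau ew; apply/eqP.
exact: insertion_row_word (valP T).
Qed.

Lemma syt_weak_refl n (T : syt n) : syt_weak T T.
Proof.
by have [w wT] := knuth_class_neq0 T; apply: t_step; exists w, w; split=> //; apply: connect0.
Qed.

Lemma subseq_pair_asym (s : seq nat) x y : uniq s ->
  subseq [:: x; y] s -> ~~ subseq [:: y; x] s.
Proof.
move=> us /subseq_pairP[i [j [/andP[ij js] <- <-]]].
apply/negP => /subseq_pairP[j' [i' [/andP[ij' is']]]].
have ltjs := ltn_trans ij' is'; have ltis := ltn_trans ij js.
by move=> /eqP + /eqP; rewrite !nth_uniq // => /eqP ej /eqP ei; lia.
Qed.

Lemma mem_row_flatten (T : tableau) i x : x \in nth [::] T i -> x \in flatten T.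
Proof.
move=> xT; apply/flattenP; exists (nth [::] T i) => //; apply: mem_nth.
by rewrite ltnNge; apply: contraTN xT => le; rewrite nth_default.
Qed.

Lemma subseq_lower_row T i j x y : i < j ->
  x \in nth [::] T i -> y \in nth [::] T j -> subseq [:: y; x] (row_word T).
Proof.
elim: T i j => [|r T IH] i j ij; first by rewrite nth_nil.
rewrite row_word_cons; case: j ij => // j; case: i => [_ xr yT|i ij xT yT].
  rewrite -cat1s cat_subseq ?sub1seq // (perm_mem (perm_row_word T)).
  exact: (@mem_row_flatten T j).
exact: subseq_trans (IH i j ij xT yT) (prefix_subseq _ _).
Qed.

Lemma subseq_same_row T i x y : sorted ltn (nth [::] T i) -> x < y ->
  x \in nth [::] T i -> y \in nth [::] T i -> subseq [:: x; y] (row_word T).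
Proof.
elim: T i => [|r T IH] i; first by rewrite nth_nil.
rewrite row_word_cons; case: i => [|i] /= sr xy; last first.
  move=> xT yT; exact: subseq_trans (IH i sr xy xT yT) (prefix_subseq _ _).
case/(nthP 0)=> p ltp eqx /(nthP 0)[q ltq eqy]; apply: subseq_trans (suffix_subseq _ _).
apply/subseq_pairP; exists p, q; split=> //; rewrite ltq andbT ltnNge.
apply: contraL xy; rewrite -eqx -eqy -leqNgt => qp.
have [->//|nqp] := eqVneq q p.
by apply: ltnW; apply: (sorted_ltn_nth ltn_trans 0 sr); rewrite ?inE // ltn_neqAle nqp.
Qed.

Lemma sorted_row T i : all (sorted ltn) T -> sorted ltn (nth [::] T i).
Proof.
move=> sT; have [lt|ge] := ltnP i (size T); last by rewrite nth_default.
by rewrite (allP sT) ?mem_nth.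
Qed.

Lemma descent_rows n (T : tableau) k i j : is_syt n T ->
  k \in nth [::] T i -> k.+1 \in nth [::] T j -> descent T k = (i < j).
Proof.
move=> sT kT k1T; have uT := uniq_row_word sT.
have [ij|ji] := ltnP i j; first exact: subseq_lower_row kT k1T.
apply/negbTE/(subseq_pair_asym uT).
move: ji; rewrite leq_eqVlt => /predU1P[eji|ji]; last exact: subseq_lower_row k1T kT.
rewrite eji in k1T; have [_ sr _ _] := and4P sT.
exact: subseq_same_row (sorted_row i sr) (ltnSn k) kT k1T.
Qed.

Lemma row_entry n (T : tableau) i x : is_syt n T -> x \in nth [::] T i -> 0 < x <= n.
Proof.
case/and4P=> _ _ _ pT /mem_row_flatten.
by rewrite (perm_mem pT) mem_iota add1n ltnS.
Qed.

(** * Subtableaux *)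

Lemma row_above n (T : tableau) i j : is_syt n T -> j < size (nth [::] T i.+1) ->
  j < size (nth [::] T i) /\ nth 0 (nth [::] T i) j < nth 0 (nth [::] T i.+1) j.
Proof.
case/and4P=> _ _ bT _ jT.
have iT : i.+1 < size T.
  by rewrite ltnNge; apply: contraTN jT => le; rewrite nth_default.
have b := nth_below bT iT; split; last exact: below_refines b jT.
by case/andP: b => le _; apply: leq_trans le.
Qed.

Lemma size_filter_leq k r j : sorted ltn r -> j < size r ->
  (j < size [seq x <- r | x <= k]) = (nth 0 r j <= k).
Proof.
move=> /(sorted_ltn_split k) er jr.
have := jr; rewrite {1}er size_cat => js; rewrite {2}er nth_cat; case: ifP => jk.
  by apply/esym; have := mem_nth 0 jk; rewrite mem_filter => /andP[].
have : nth 0 [seq x <- r | k < x] (j - size [seq x <- r | x <= k])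
    \in [seq x <- r | k < x].
  by apply: mem_nth; move/negbT: jk; rewrite -leqNgt => le; rewrite ltn_subLR.
by rewrite mem_filter ltnNge => /andP[/negbTE].
Qed.

Lemma nth_filter_leq k r j : sorted ltn r -> j < size [seq x <- r | x <= k] ->
  nth 0 [seq x <- r | x <= k] j = nth 0 r j.
Proof.
by move=> /(sorted_ltn_split k) er jk; rewrite [in RHS]er nth_cat jk.
Qed.

Lemma flatten_nonempty (T : tableau) : flatten [seq r <- T | 0 < size r] = flatten T.
Proof. by elim: T => //= -[|x r] T IH //=; rewrite IH. Qed.

Lemma subtableau_syt n k (T : tableau) : k <= n -> is_syt n T ->
  is_syt k (subtableau k T).
Proof.
move=> kn sT; have [_ sr bT pT] := and4P sT.
apply/and4P; split.
- exact: filter_all.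
- apply/allP => r; rewrite mem_filter => /andP[_ /mapP[r' r'T ->]].
  by rewrite sorted_filter ?(allP sr) //; apply: ltn_trans.
- apply/(sortedP [::]) => i _; rewrite !nth_subtableau //.
  have cell j : j < size [seq x <- nth [::] T i.+1 | x <= k] ->
      j < size [seq x <- nth [::] T i | x <= k] /\
      nth 0 [seq x <- nth [::] T i | x <= k] j <
      nth 0 [seq x <- nth [::] T i.+1 | x <= k] j.
    move=> jk; have jT := leq_trans jk (size_subseq (filter_subseq _ _)).
    have [ji lt] := row_above sT jT.
    have jk' : j < size [seq x <- nth [::] T i | x <= k].
      rewrite size_filter_leq ?sorted_row // (leq_trans (ltnW lt)) //.
      by rewrite -size_filter_leq ?sorted_row.
    by rewrite jk' !nth_filter_leq ?sorted_row.
  apply/andP; split; last by apply/allP => j; rewrite mem_iota => /cell[].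
  by rewrite leqNgt; apply/negP => /cell[]; rewrite ltnn.
- rewrite flatten_nonempty -filter_flatten (permPl (perm_filter _ pT)).
  rewrite -{1}(subnKC kn) iotaD filter_cat.
  rewrite (all_filterP (_ : all _ (iota 1 k))); last first.
    by apply/allP => x; rewrite mem_iota; lia.
  rewrite (eq_in_filter (a2 := pred0)) ?filter_pred0 ?cats0 // => x.
  by rewrite mem_iota add1n => /andP[kx _]; rewrite leqNgt kx.
Qed.

(** Remove one cell from the end of row [i], which leaves a partition since that
    row is longer than the next one; fill the remaining cells with
    [1, ..., k - 1], row after row; and put [k] into the removed cell.  Below,
    [lam] and [mu] are the row lengths before and after the removal, and
    [off j] counts the cells of [mu] above row [j]. *)
Lemma syt_with_max_at_corner k (R : syt k) i :
  size (nth [::] (val R) i.+1) < size (nth [::] (val R) i) ->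
  exists R' : syt k, shape (val R) = shape (val R') /\ k \in nth [::] (val R') i.
Proof.
case: R => R /= sR corner; set m := size R.
pose lam j := size (nth [::] R j); pose mu j := lam j - (j == i).
pose off j := \sum_(0 <= l < j) mu l.
pose fill j := iota (off j).+1 (mu j) ++ nseq (j == i) k.
have im : i < m.
  by rewrite ltnNge; apply: contraTN corner => le; rewrite (nth_default _ le).
have lam_i : 0 < lam i by apply: leq_trans corner.
have lam_mu j : lam j = mu j + (j == i).
  by rewrite subnK //; case: eqP => // ->.
have offS j : off j.+1 = off j + mu j by rewrite /off big_nat_recr.
have [R0 Rr _ Rp] := and4P sR.
have k_off : k = (off m).+1.
  rewrite -[k](size_iota 1) -(perm_size Rp) size_flatten.
  have -> : shape R = mkseq lam m.
    apply: (@eq_from_nth _ 0); rewrite size_map ?size_mkseq // => j jm.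
    by rewrite nth_mkseq // nth_shape.
  rewrite sumnE big_map -[m in iota 0 m]subn0 -/(index_iota 0 m).
  rewrite (eq_bigr _ (fun j _ => lam_mu j)) big_split /= -addn1; congr (_ + _).
  under eq_bigr => j _ do rewrite -[nat_of_bool _]/(if j == i then 1 else 0).
  by rewrite -big_mkcond big_nat1_eq im.
have off_le j : j < m -> off j + mu j < k.
  rewrite k_off ltnS -offS => jm; rewrite /off [leqRHS](big_cat_nat (n := j.+1)) //=.
  exact: leq_addr.
have size_fill j : size (fill j) = lam j.
  by rewrite size_cat size_iota size_nseq -lam_mu.
have nth_fill j l : l < lam j ->
    nth 0 (fill j) l = if l < mu j then (off j).+1 + l else k.
  move=> lj; rewrite nth_cat size_iota; case: ifP => [h|/negbT h].
    by rewrite nth_iota.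
  by rewrite nth_nseq ifT //; move: lj h; rewrite lam_mu; lia.
have lam_le j : j.+1 < m -> lam j.+1 <= lam j.
  by case/and4P: sR => _ _ bR _ jm; case/andP: (nth_below bR jm).
have nthR' j : nth [::] (mkseq fill m) j = if j < m then fill j else [::].
  by case: ltnP => jm; [rewrite nth_mkseq | rewrite nth_default ?size_mkseq].
have sR' : is_syt k (mkseq fill m).
  apply/and4P; split.
  - apply/(all_nthP [::]) => j; rewrite size_mkseq => jm.
    by rewrite nth_mkseq // size_fill (all_nthP [::] R0).
  - apply/(all_nthP [::]) => j; rewrite size_mkseq => jm; rewrite nth_mkseq //.
    rewrite (sorted_pairwise ltn_trans) pairwise_cat -(sorted_pairwise ltn_trans).
    rewrite iota_ltn_sorted /= andbC.
    have -> : pairwise ltn (nseq (j == i) k) by case: (j == i).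
    apply/allrelP => x y; rewrite mem_iota mem_nseq => /andP[_ xj] /andP[_ /eqP ->].
    by apply: leq_ltn_trans (off_le j jm); lia.
  - apply/(sortedP [::]) => j; rewrite size_mkseq => jm.
    rewrite !nth_mkseq ?(ltnW jm) // /below !size_fill lam_le //=.
    have cell l : l < lam j.+1 -> nth 0 (fill j) l < nth 0 (fill j.+1) l.
      move=> lj; rewrite !nth_fill ?(leq_trans lj (lam_le j jm)) // offS.
      have le1 := off_le _ jm; have le0 := off_le _ (ltnW jm); rewrite offS in le1.
      have mu0 := lam_mu j; have mu1 := lam_mu j.+1; have le := lam_le _ jm.
      have strict : lam j.+1 + (j == i) <= lam j.
        by case: eqP => [->|_]; rewrite ?addn1 ?addn0.
      by case: (ltnP l (mu j)); case: (ltnP l (mu j.+1)); lia.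
    by apply/allP => l; rewrite mem_iota => /cell.
  - rewrite (permPl (perm_flatten_cat _ _ _)).
    have -> p : flatten [seq iota (off j).+1 (mu j) | j <- iota 0 p] = iota 1 (off p).
      elim: p => [|p IH]; first by rewrite /off big_geq.
      by rewrite -addn1 iotaD map_cat flatten_cat IH /= cats0 addn1 offS iotaD add0n add1n.
    have -> p : flatten [seq nseq (j == i) k | j <- iota 0 p] = nseq (i < p) k.
      elim: p => // p IH.
      rewrite -addn1 iotaD map_cat flatten_cat IH /= cats0 addn1 add0n.
      by rewrite ltnS [i <= p]leq_eqVlt [p == i]eq_sym; have [] := ltngtP i p.
    suff -> : iota 1 k = iota 1 (off m) ++ [:: k] by rewrite im.
    by rewrite {1}k_off -[(off m).+1]addn1 iotaD add1n -k_off.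
exists (exist (fun T => is_true (is_syt k T)) _ sR'); split=> /=.
  apply: (@eq_from_nth _ 0); rewrite !size_map ?size_iota // => j jm.
  by rewrite !nth_shape nthR' jm size_fill.
by rewrite nthR' im mem_cat mem_nseq eqxx /= eqxx orbT.
Qed.

(** * Inner translation and antisymmetry *)

Lemma descent_translation n k (R R' : syt k) (sh : shape (val R) = shape (val R'))
    (T : syt_over n R) i j :
  k \in nth [::] (val R') i -> k.+1 \in nth [::] (val (val T)) j ->
  descent (val (val (inner_translation sh T))) k = (i < j).
Proof.
move=> kR' k1T; have [_ sr bT _] := and4P (valP (val T)).
have eR l : nth [::] (val R) l = [seq x <- nth [::] (val (val T)) l | x <= k].
  by rewrite -nth_subtableau // (eqP (valP T)).
have iT : i < size (val (val T)).
  rewrite ltnNge; apply: contraTN kR' => le.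
  by rewrite (size0nil (s := nth [::] (val R') i)) // -(size_nth_shape i sh) eR nth_default.
have rowV l : l < size (val (val T)) ->
    nth [::] (val (val (inner_translation sh T))) l =
    nth [::] (val R') l ++ drop (size (nth [::] (val R') l)) (nth [::] (val (val T)) l).
  by move=> lT; rewrite (nth_map 0) ?size_iota // nth_iota.
apply: descent_rows (valP _) _ _; first by rewrite rowV // mem_cat kR'.
have jT : j < size (val (val T)).
  by rewrite ltnNge; apply: contraTN k1T => le; rewrite nth_default.
rewrite rowV // mem_cat; apply/orP; right.
rewrite -(size_nth_shape j sh) eR.
have eT := sorted_ltn_split k (sorted_row j sr).
rewrite [X in drop _ X]eT drop_size_cat //.
by move: k1T; rewrite [in X in X -> _]eT mem_cat mem_filter ltnn.
Qed.

(** The entry above [k.+1] is at most [k], so it belongs to the subtableau, whose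
    row [j.+1] ends before that column. *)
Lemma next_entry_corner n k (T : tableau) j : is_syt n T ->
  k.+1 \in nth [::] T j.+1 ->
  size (nth [::] (subtableau k T) j.+1) < size (nth [::] (subtableau k T) j).
Proof.
move=> sT /(nthP 0)[c cT ec]; have [_ sr bT _] := and4P sT.
have [cj lt] := row_above sT cT.
rewrite !nth_subtableau //; apply: (@leq_trans c.+1).
  by rewrite ltnS leqNgt size_filter_leq ?sorted_row // ec ltnn.
by rewrite size_filter_leq ?sorted_row // -ltnS -ec.
Qed.

(** Were [k.+1] in a lower row [a.+1] of [S] than of [T], an inner tableau with
    [k] at the end of row [a] would make [k] a descent of the translate of [S]
    only. *)
Lemma syt_weak_next_row n (S T : syt n) k a b : inner_translation_conjecture ->
  k < n -> subtableau k (val S) = subtableau k (val T) -> syt_weak S T ->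
  k.+1 \in nth [::] (val S) a -> k.+1 \in nth [::] (val T) b -> a <= b.
Proof.
move=> itc kn eST ST k1S k1T; case: a k1S => // a k1S; rewrite ltnNge; apply/negP => ba.
have sR := subtableau_syt (ltnW kn) (valP S).
pose R : syt k := exist (fun U => is_true (is_syt k U)) _ sR.
have SR : subtableau k (val S) == val R by [].
have TR : subtableau k (val T) == val R by rewrite -eST.
pose S' : syt_over n R := exist (fun U : syt n => subtableau k (val U) == val R) S SR.
pose T' : syt_over n R := exist (fun U : syt n => subtableau k (val U) == val R) T TR.
have corner := next_entry_corner (valP S) k1S.
have [R' [sh kR']] := @syt_with_max_at_corner k R a corner.
have /andP[k0 _] := row_entry (valP R') kR'.
have kn' : 0 < k < n by rewrite k0.
have := syt_weak_descent (k := k) (itc n k kn' R R' sh S' T' ST).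
rewrite (descent_translation (j := a.+1) sh kR') //.
by rewrite (descent_translation (j := b) sh kR') // ltnSn ltnNge ba => /(_ isT).
Qed.

Lemma mem_row n (T : tableau) x : is_syt n T -> 0 < x <= n ->
  exists i, x \in nth [::] T i.
Proof.
case/and4P=> _ _ _ pT x_n.
have : x \in flatten T by rewrite (perm_mem pT) mem_iota add1n ltnS.
by case/flattenP=> r /(nthP [::])[i _ <-] xr; exists i.
Qed.

Lemma eq_tableau (A B : tableau) :
  all (fun r => 0 < size r) A -> all (fun r => 0 < size r) B ->
  (forall i, nth [::] A i = nth [::] B i) -> A = B.
Proof.
move=> A0 B0 e.
have le (C D : tableau) : all (fun r => 0 < size r) C ->
    (forall i, nth [::] C i = nth [::] D i) -> size C <= size D.
  move=> C0 eCD; rewrite leqNgt; apply/negP=> lt.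
  by have := all_nthP [::] C0 _ lt; rewrite eCD nth_default.
apply: (@eq_from_nth _ [::]) => [|i _ //].
by apply/eqP; rewrite eqn_leq !le.
Qed.

Lemma subtableau_full n (T : tableau) : is_syt n T -> subtableau n T = T.
Proof.
move=> sT; have [T0 sr bT _] := and4P sT; apply: eq_tableau T0 _ => [|i]; first exact: filter_all.
rewrite nth_subtableau //; apply/all_filterP/allP => x /row_entry xT.
by case/andP: (xT n sT).
Qed.

Lemma eq_subtableau n (S T : syt n) k : inner_translation_conjecture ->
  syt_weak S T -> syt_weak T S -> k <= n ->
  subtableau k (val S) = subtableau k (val T).
Proof.
move=> itc ST TS; have [_ sS bS _] := and4P (valP S).
have [_ sT bT _] := and4P (valP T).
elim: k => [|k IH] kn.
  apply: eq_tableau; try exact: filter_all; move=> i; rewrite !nth_subtableau //.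
  have no0 (U : syt n) : [seq x <- nth [::] (val U) i | x <= 0] = [::].
    rewrite (eq_in_filter (a2 := pred0)) ?filter_pred0 // => x /(row_entry (valP U)).
    by case/andP=> x0 _; rewrite leqNgt x0.
  by rewrite !no0.
have {}IH := IH (ltnW kn).
have next_sub (A B : syt n) i : syt_weak A B -> syt_weak B A ->
    subtableau k (val A) = subtableau k (val B) ->
    k.+1 \in nth [::] (val A) i -> k.+1 \in nth [::] (val B) i.
  move=> AB BA eAB kA; have [|j kB] := mem_row (x := k.+1) (valP B); first by rewrite kn.
  have ij := syt_weak_next_row itc kn eAB AB kA kB.
  have ji := syt_weak_next_row itc kn (esym eAB) BA kB kA.
  by have -> : i = j by apply/eqP; rewrite eqn_leq ij.
apply: eq_tableau; try exact: filter_all; move=> i; rewrite !nth_subtableau //.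
apply: (irr_sorted_eq ltn_trans ltnn); rewrite ?sorted_filter ?sorted_row //; try exact: ltn_trans.
move=> x; rewrite !mem_filter; have [->|nx] := eqVneq x k.+1.
  by rewrite leqnn /=; apply/idP/idP; apply: next_sub.
have := congr1 (fun R : tableau => x \in nth [::] R i) IH.
by rewrite !nth_subtableau // !mem_filter [x <= k.+1]leq_eqVlt (negbTE nx) ltnS.
Qed.

Theorem theorem3p1 :
  inner_translation_conjecture ->
  forall n : nat,
    Relation_Definitions.antisymmetric (syt n) (@syt_weak n) /\
    Relation_Definitions.order (syt n) (@syt_weak n).
Proof.
move=> itc n.
have anti : Relation_Definitions.antisymmetric (syt n) (@syt_weak n).
  move=> S T ST TS; apply: val_inj.
  rewrite /= -(subtableau_full (valP S)) -(subtableau_full (valP T)).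
  exact: eq_subtableau.
split=> //; split=> //; first exact: syt_weak_refl.
by move=> S T U; apply: t_trans.
Qed.
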